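(* Let $n\geq 3$ and let $\alpha,\beta\in\mathcal{AOP}_n$ be two elements of rank $n-1$. Then: (1) if $n$ is odd, $\alpha\mathscr{J}\beta$ in $\mathcal{AOP}_n$; (2) if $n$ is even, $\alpha\mathscr{J}\beta$ in $\mathcal{AOP}_n$ if and only if $\mathrm{d}(\alpha)$ and $\mathrm{d}(\beta)$ have the same parity.
   Context: Let $\Omega_n=\{1<2<\cdots<n\}$ and let $\mathcal{I}_n$ be the symmetric inverse monoid on $\Omega_n$, i.e. the monoid of all injective partial maps (partial permutations) of $\Omega_n$ under composition of partial maps. The alternating inverse monoid is $\mathcal{AI}_n=\{\alpha\in\mathcal{I}_n : \alpha=\sigma|_{\mathrm{Dom}(\alpha)}\text{ for some even permutation }\sigma\text{ of }\Omega_n\}$. A partial permutation $\alpha$ with $\mathrm{Dom}(\alpha)=\{a_1<\cdots<a_t\}$, $t\geq 0$, is orientation-preserving if there is at most one index $i\in\{1,\ldots,t\}$ with $a_i\alpha>a_{i+1}\alpha$, where $a_{t+1}$ denotes $a_1$. $\mathcal{AOP}_n$ is the inverse submonoid of $\mathcal{I}_n$ of all orientation-preserving elements of $\mathcal{AI}_n$. The rank of $\alpha$ is $|\mathrm{Im}(\alpha)|$. For $\alpha$ of rank $n-1$, $\mathrm{d}(\alpha)$ is the unique element of $\Omega_n\setminus\mathrm{Dom}(\alpha)$. In a monoid $M$, $a\mathscr{J}b$ means $MaM=MbM$. *)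

(* Defs.v *)
From HB Require Import structures.
From mathcomp Require Import all_boot all_fingroup.

Set Implicit Arguments.
Unset Strict Implicit.
Unset Printing Implicit Defensive.

Local Open Scope group_scope.

(* The element k of {1 < 2 < ... < n} is encoded by the ordinal k.-1 : 'I_n;
   label recovers k. *)
Definition label n (i : 'I_n) : nat := i.+1.

Definition pinjective n (f : {ffun 'I_n -> option 'I_n}) : bool :=
  [forall x, forall y, (f x != None) && (f x == f y) ==> (x == y)].

Lemma pinjectiveP n (f : {ffun 'I_n -> option 'I_n}) :
  reflect (forall x y z, f x = Some z -> f y = Some z -> x = y) (pinjective f).
Proof.
apply: (iffP forallP) => [inj x y z fx fy | inj x].
  by have /forallP/(_ y) := inj x; rewrite fx fy eqxx => /eqP.
apply/forallP=> y; apply/implyP=> /andP[].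
case fx: (f x) => [z|] // _ /eqP/esym fy.
by apply/eqP; apply: inj fx fy.
Qed.

(* The symmetric inverse monoid I_n: a x = None means that x is outside the
   domain of a. *)
Record pperm n := PPerm {
  pperm_fun :> {ffun 'I_n -> option 'I_n};
  _ : pinjective pperm_fun
}.

HB.instance Definition _ n := [isSub for @pperm_fun n].
HB.instance Definition _ n := [Finite of pperm n by <:].

Lemma pperm_inj n (a : pperm n) x y z : a x = Some z -> a y = Some z -> x = y.
Proof. exact: (pinjectiveP _ (valP a)). Qed.

(* Maps act on the right, as in the group 'S_n: in a * b, a is applied first. *)
Definition pcomp_fun n (a b : pperm n) : {ffun 'I_n -> option 'I_n} :=
  [ffun x => obind b (a x)].

Lemma pcomp_subproof n (a b : pperm n) : pinjective (pcomp_fun a b).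
Proof.
apply/pinjectiveP=> x y z; rewrite !ffunE.
case ax: (a x) => [u|] //= bu; case ay: (a y) => [v|] //= bv.
by apply: (@pperm_inj _ a x y u); rewrite // ay (pperm_inj bu bv).
Qed.

Definition pcomp n (a b : pperm n) : pperm n := PPerm (pcomp_subproof a b).

Lemma pid_subproof n : pinjective [ffun x : 'I_n => Some x].
Proof. by apply/pinjectiveP=> x y z; rewrite !ffunE => -[->] [->]. Qed.

Definition pid n : pperm n := PPerm (pid_subproof n).

Lemma pcompE n (a b : pperm n) x : pcomp a b x = obind b (a x).
Proof. by rewrite /= ffunE. Qed.

Lemma pidE n (x : 'I_n) : pid n x = Some x.
Proof. by rewrite /= ffunE. Qed.

Lemma pcompA n : associative (@pcomp n).
Proof.
move=> a b c; apply/val_inj/ffunP=> x; rewrite !pcompE.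
by case: (a x) => //= y; rewrite pcompE.
Qed.

Lemma pcomp1p n : left_id (pid n) (@pcomp n).
Proof. by move=> a; apply/val_inj/ffunP=> x; rewrite pcompE pidE. Qed.

Lemma pcompp1 n : right_id (pid n) (@pcomp n).
Proof.
move=> a; apply/val_inj/ffunP=> x; rewrite pcompE.
by case: (a x) => //= y; rewrite pidE.
Qed.

HB.instance Definition _ n :=
  isMonoid.Build (pperm n) (@pcompA n) (@pcomp1p n) (@pcompp1 n).

Definition dom n (a : pperm n) : {set 'I_n} := [set x | a x != None].

Definition im n (a : pperm n) : {set 'I_n} :=
  [set y | [exists x, a x == Some y]].

Definition rank n (a : pperm n) : nat := #|im a|.

Definition alternating n (a : pperm n) : bool :=
  [exists s : 'S_n, ~~ odd_perm s && [forall x in dom a, a x == Some (s x)]].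

(* If the domain is {a_1 < ... < a_t}, this is the sequence of the images of
   a_1, ..., a_t, since enum 'I_n is increasing and pmap drops the points
   outside the domain. *)
Definition images n (a : pperm n) : seq 'I_n := pmap a (enum 'I_n).

(* Number of descents of s, the last item being followed by the first one. *)
Definition cyclic_descents n (s : seq 'I_n) : nat :=
  count (fun p : 'I_n * 'I_n => p.2 < p.1) (zip s (rot 1 s)).

Definition orientation_preserving n (a : pperm n) : bool :=
  cyclic_descents (images a) <= 1.

Definition AI n : {set pperm n} := [set a | alternating a].

Definition AOP n : {set pperm n} := [set a in AI n | orientation_preserving a].

(* x \in M a M, for a submonoid M of G. *)
Definition in_ideal (G : monoidType) (M : {pred G}) (a x : G) : Prop :=
  exists u v, [/\ u \in M, v \in M & x = u * a * v].

Definition green_J (G : monoidType) (M : {pred G}) (a b : G) : Prop :=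
  forall x, in_ideal M a x <-> in_ideal M b x.

(* i = d(a): i is the unique element outside the domain of a. *)
Definition is_d n (a : pperm n) (i : 'I_n) : Prop := ~: dom a = [set i].

Lemma card_dom n (a : pperm n) : #|dom a| = rank a.
Proof.
have injS : injective (@Some 'I_n) by move=> x y [].
rewrite /rank -(card_imset (im a) injS).
have /card_in_imset <- : {in dom a &, injective a}.
  move=> x y; rewrite inE; case ax: (a x) => [z|] // _ _ /esym ay.
  exact: pperm_inj ax ay.
apply: eq_card => o; apply/imsetP/imsetP => [[x] | [y]].
  rewrite inE; case ax: (a x) => [z|] // _ ->; exists z => //.
  by rewrite inE; apply/existsP; exists x; rewrite ax.
by rewrite inE => /existsP[x /eqP ax] ->; exists x; rewrite ?inE ax.
Qed.

Lemma d_exists n (a : pperm n) : 0 < n -> rank a = n.-1 -> exists i, is_d a i.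
Proof.
move=> n_gt0 ra; apply/cards1P.
rewrite cardsCs setCK card_ord card_dom ra.
by case: n n_gt0 {a ra} => // n _; rewrite subSnn.
Qed.

(* Main.v *)
Require Import Defs.
From mathcomp Require Import all_boot all_fingroup zify.

Set Implicit Arguments.
Unset Strict Implicit.
Unset Printing Implicit Defensive.

(* A partial permutation is orientation-preserving iff it preserves the ternary
   cyclic order, so AOP_n is closed under products and inverses.  If a rotation r
   that is an even permutation sends d(b) to d(a), then b = r a (a^-1 r^-1 b)
   lies in the ideal of a; such an r exists when n is odd (all rotations are
   even) or d(a) - d(b) is even (r is the square of a rotation).  Conversely, let
   n be even and b = u a v.  The even permutation s extending u sends d(b) to
   d(a), and on the n-1 remaining points it is order-isomorphic to a
   cyclic-order-preserving permutation of n-1 points, that is to a rotation, which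
   is even since n-1 is odd.  So the sign of s is (-1)^(d(a) - d(b)). *)

(** * Cyclic order and cyclic descents *)

Definition cyc (x y z : nat) : bool :=
  [|| x < y < z, y < z < x | z < x < y].

Lemma cyc_min x y z : x < y -> x < z -> cyc x y z -> y < z.
Proof. by rewrite /cyc; lia. Qed.

Definition cyc_on n (D : {set 'I_n}) (f : 'I_n -> 'I_n) : Prop :=
  {in D & &, forall x y z : 'I_n, cyc x y z -> cyc (f x) (f y) (f z)}.

Lemma zip_rot (T U : Type) r (s : seq T) (t : seq U) : size s = size t ->
  zip (rot r s) (rot r t) = rot r (zip s t).
Proof.
move=> st; rewrite /rot zip_cat ?size_drop ?st //; congr (_ ++ _).
  elim: r s t st => [|r IH] [|x s] [|y t] //= [st].
  exact: IH.
by elim: r s t st => [|r IH] [|x s] [|y t] //= [st]; rewrite IH.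
Qed.

Lemma cyclic_descents_rot n r (s : seq 'I_n) :
  cyclic_descents (rot r s) = cyclic_descents s.
Proof.
rewrite /cyclic_descents rot_rot zip_rot ?size_rot //.
by apply: seq.permP; rewrite perm_rot.
Qed.

(** As [y] lies below the last item, the closing pair is a descent, so a total of at most one leaves
    none along the path. The induction needs [0 < c] when the head pair descends. *)
Lemma count_descents_last n (x y : 'I_n) s : y < last x s ->
  let c := count (fun p : 'I_n * 'I_n => p.2 < p.1) (zip (x :: s) (rcons s y)) in
  0 < c /\ (c <= 1) = path (relpre val leq) x s.
Proof.
elim: s x => [|z s IH] x /=; first by move=> ->.
move=> /IH /= []; set c := count _ _ => c0 c1; rewrite -c1.
by split; [lia | case: ltnP => /= _; lia].
Qed.

Lemma cyclic_descents_min n (x : 'I_n) s : all (fun y : 'I_n => x < y) s ->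
  (cyclic_descents (x :: s) <= 1) = sorted (relpre val leq) (x :: s).
Proof.
case: s => [|z s]; first by rewrite /cyclic_descents /= ltnn.
move=> xs; rewrite /cyclic_descents rot1_cons.
have lt_last : x < last x (z :: s) by apply: (allP xs); rewrite [last _ _]/=; apply: mem_last.
by have [_ ->] := count_descents_last lt_last.
Qed.

Lemma sorted_enum_set n (D : {set 'I_n}) : sorted (relpre val ltn) (enum D).
Proof.
rewrite {1}/enum_mem; apply: sorted_filter; first by move=> ? ? ?; apply: ltn_trans.
by rewrite -enumT -sorted_map val_enum_ord iota_ltn_sorted.
Qed.

(* Going around the cycle from m, x is met before y iff from m x < from m y. *)
Definition from n (m x : 'I_n) : nat := if m <= x then x : nat else x + n.

(** Cutting the cycle before [m] instead of before [0] does not affect the cyclic order. *)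
Lemma cyc_from n (m x y z : 'I_n) :
  cyc x y z = cyc (from m x) (from m y) (from m z).
Proof.
rewrite /from /cyc; have := ltn_ord x; have := ltn_ord y; have := ltn_ord z.
have := ltn_ord m.
case: (leqP m x) => ?; case: (leqP m y) => ?; case: (leqP m z) => ?; lia.
Qed.

(** Let [m] be the point of [D] with the least image. Both sides then say that [f] is increasing on
    [D] ordered by [from m]. *)
Lemma cyclic_descentsP n (D : {set 'I_n}) (f : 'I_n -> 'I_n) : injective f ->
  cyclic_descents (map f (enum D)) <= 1 <-> cyc_on D f.
Proof.
move=> injf; have [->|[m0 m0D]] := set_0Vmem D.
  by rewrite enum_set0; split=> // _ x; rewrite inE.
have [m mD minm] := arg_minnP (fun x => val (f x)) m0D.
have ltfm y : y \in D -> y != m -> f m < f y.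
  move=> yD ne; rewrite ltn_neqAle minm // andbT.
  by apply: contraNneq ne => /val_inj/injf ->.
have := sorted_enum_set D; have := enum_uniq D; have := mem_enum D.
have : m \in enum D by rewrite mem_enum.
case/splitPr: (enum D) / => d1 d2 eD ud.
rewrite sorted_pairwise; last by move=> ? ? ?; apply: ltn_trans.
rewrite pairwise_cat /= => /and3P[a12 p1 /andP[am p2]].
have a1m : all (fun x : 'I_n => x < m) d1.
  by apply/allP=> x xd; apply: (allrelP a12) => //; rewrite inE eqxx.
(* Moving [d1] behind [m :: d2] lists [D] in the order in which it is met from [m]. *)
rewrite -(cyclic_descents_rot (size d1)) -map_rot rot_size_cat /=.
set e := m :: (d2 ++ d1).
have memE x : (x \in e) = (x \in D).
  by rewrite -(eD x) !(inE, mem_cat) orbC -orbA orbC -orbA; congr (_ || _); rewrite orbC.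
have ue : uniq e.
  by rewrite -[e]/((m :: d2) ++ d1) -(rot_size_cat d1) rot_uniq.
have trr (g : 'I_n -> nat) : transitive (relpre g ltn).
  by move=> ? ? ?; apply: ltn_trans.
have se : sorted (relpre (from m) ltn) e.
  rewrite sorted_pairwise; last exact: trr.
  have fromR x : x \in d2 -> from m x = x.
    by move=> /(allP am) /ltnW le; rewrite /from le.
  have fromL x : x \in d1 -> from m x = x + n.
    by move=> /(allP a1m) lt; rewrite /from leqNgt lt.
  have fromm : from m m = m by rewrite /from leqnn.
  rewrite /= all_cat pairwise_cat; apply/and3P; split; last apply/andP; last split.
  - apply/andP; split; apply/allP=> x xd /=; rewrite fromm.
      by rewrite fromR //; apply: (allP am).
    by rewrite fromL // ltn_addl.
  - apply/allrelP=> x y xd yd /=; rewrite fromR // fromL //.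
    by rewrite ltn_addl ?ltn_ord.
  - apply: (sub_in_pairwise _ (allss d2)) p2 => x y xd yd /=.
    by rewrite !fromR.
  - apply: (sub_in_pairwise _ (allss d1)) p1 => x y xd yd /=.
    by rewrite !fromL // ltn_add2r.
have fsorted : sorted (relpre f (relpre val ltn)) e <->
    {in D &, forall x y, from m x < from m y -> f x < f y}.
  split=> [sf x y xD yD lt_xy | mono]; last first.
    by apply: (sub_in_sorted _ (allss e)) se => x y; rewrite !memE => *; apply: mono.
  have [xe ye] : x \in e /\ y \in e by rewrite !memE.
  apply: (sorted_ltn_index (trr (fun x => val (f x))) sf) => //.
  have [//|le] := ltnP (index x e) (index y e).
  move: le; rewrite leq_eqVlt => /orP[/eqP eyx|].
    by move: lt_xy; rewrite (index_inj y ye xe eyx) ltnn.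
  by move/(sorted_ltn_index (trr _) se y x ye xe)/ltnW; rewrite leqNgt lt_xy.
have -> : (cyclic_descents (f m :: map f (d2 ++ d1)) <= 1) =
    sorted (relpre f (relpre val ltn)) e.
  (* The images start at their minimum, and injectivity of [f] turns weakly sorted into strictly
     sorted. *)
  rewrite cyclic_descents_min -?[f m :: _]/(map f e).
    have := ltn_sorted_uniq_leq (map val (map f e)).
    by rewrite !sorted_map !map_inj_uniq ?ue //; apply: val_inj.
  apply/allP=> _ /mapP[y yin ->]; apply: ltfm.
    by rewrite -memE inE yin orbT.
  by apply: contraTneq yin => ->; have /andP[] := ue.
rewrite fsorted; split=> [mono x y z xD yD zD|cycf x y xD yD lt_xy].
  rewrite (cyc_from m) /cyc.
  by case/or3P=> /andP[/mono-> // /mono->]; rewrite ?orbT.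
have from_gt z : z != m -> from m m < from m z.
  move=> ne; rewrite /from leqnn.
  case: (leqP m z) => [|_]; last by rewrite ltn_addl.
  by rewrite leq_eqVlt val_eqE eq_sym (negPf ne).
have ym : y != m.
  apply: contraTneq lt_xy => ->; rewrite -leqNgt.
  by have [->//|/from_gt/ltnW] := eqVneq x m.
have [->|xm] := eqVneq x m; first exact: ltfm.
(* Since [f m] is least, this cyclic triple forces [f x < f y]. *)
have : cyc (f m) (f x) (f y).
  by apply: cycf => //; rewrite (cyc_from m) /cyc lt_xy from_gt.
exact: cyc_min (ltfm _ xD xm) (ltfm _ yD ym).
Qed.

(** * Restrictions of permutations, and closure properties of [AOP n] *)

Local Open Scope group_scope.

Lemma cyc_asym (x y z : nat) : cyc x y z -> ~~ cyc x z y.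
Proof. by rewrite /cyc; lia. Qed.

Lemma cyc_total (x y z : nat) :
  [&& x != y, y != z & x != z] -> cyc x y z || cyc x z y.
Proof. by rewrite /cyc; lia. Qed.

Lemma cyc_neq (x y z : nat) : cyc x y z -> [&& x != y, y != z & x != z].
Proof. by rewrite /cyc; lia. Qed.

(** The cyclic order is asymmetric and total on distinct triples, so an injection preserving it also
    reflects it. *)
Lemma cyc_on_inv n (s : 'S_n) D : cyc_on D s -> cyc_on (s @: D) s^-1.
Proof.
move=> cycs _ _ _ /imsetP[x xD ->] /imsetP[y yD ->] /imsetP[z zD ->] sxyz.
have neq : [&& x != y, y != z & x != z].
  by move: (cyc_neq sxyz); rewrite !val_eqE !(inj_eq perm_inj).
rewrite !permK; have /orP[//|/(cycs _ _ _ xD zD yD)] := cyc_total neq.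
by rewrite (negPf (cyc_asym sxyz)).
Qed.

Definition pres_fun n (s : 'S_n) (D : {set 'I_n}) : {ffun 'I_n -> option 'I_n} :=
  [ffun x => if x \in D then Some (s x) else None].

Lemma pres_subproof n (s : 'S_n) D : pinjective (pres_fun s D).
Proof.
apply/pinjectiveP=> x y z; rewrite !ffunE.
by case: ifP => // _ [<-]; case: ifP => // _ [/perm_inj].
Qed.

Definition pres n (s : 'S_n) D : pperm n := PPerm (pres_subproof s D).

Lemma presE n (s : 'S_n) D x :
  pres s D x = if x \in D then Some (s x) else None.
Proof. by rewrite /= ffunE. Qed.

Lemma dom_pres n (s : 'S_n) D : Defs.dom (pres s D) = D.
Proof. by apply/setP=> x; rewrite inE presE; case: ifP. Qed.

Lemma presM n (s t : 'S_n) D E :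
  pres s D * pres t E = pres (s * t) (D :&: s @^-1: E).
Proof.
apply/val_inj/ffunP=> x; rewrite [LHS]pcompE [RHS]presE !inE presE permM.
by case: (x \in D); rewrite //= ffunE.
Qed.

Lemma images_pres n (s : 'S_n) D : images (pres s D) = map s (enum D).
Proof.
rewrite /images [in RHS]/enum_mem -enumT; elim: (enum 'I_n) => //= x e IH.
by rewrite ffunE; case: ifP => /= _; rewrite IH.
Qed.

(** Evenness concerns all of [s], orientation only its action on [D]; keeping both reduces products
    and inverses to computations in ['S_n]. *)
Lemma AOPP n (a : pperm n) :
  reflect (exists s D, [/\ a = pres s D, ~~ odd_perm s & cyc_on D s])
          (a \in AOP n).
Proof.
apply: (iffP idP) => [|[s [D [-> evens cycs]]]].
  rewrite inE [_ \in AI n]inE => /andP[/existsP[s /andP[evens /forall_inP sE]]].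
  have aE : a = pres s (Defs.dom a).
    apply/val_inj/ffunP=> x; rewrite [RHS]presE; case: ifP => [/sE/eqP //|].
    by rewrite inE; case: (pperm_fun a x).
  rewrite /orientation_preserving {1}aE images_pres.
  move=> /(cyclic_descentsP _ (@perm_inj _ s)).
  by exists s, (Defs.dom a).
rewrite inE [_ \in AI n]inE; apply/andP; split.
  apply/existsP; exists s; rewrite evens; apply/forall_inP=> x.
  by rewrite dom_pres presE => ->.
rewrite /orientation_preserving images_pres.
by apply/cyclic_descentsP => //; apply: perm_inj.
Qed.

Lemma AOP1 n : 1 \in AOP n.
Proof.
apply/AOPP; exists 1, setT; split; last by move=> x y z _ _ _; rewrite !perm1.
  by apply/val_inj/ffunP=> x; rewrite [RHS]presE inE perm1 [LHS]pidE.
by rewrite odd_perm1.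
Qed.

Lemma AOPM n : {in AOP n &, forall a b, a * b \in AOP n}.
Proof.
move=> _ _ /AOPP[s [D [-> evens cycs]]] /AOPP[t [E [-> event cyct]]].
rewrite presM; apply/AOPP; exists (s * t), (D :&: s @^-1: E).
split=> //; first by rewrite odd_permM (negPf evens).
move=> x y z; rewrite !inE => /andP[xD xE] /andP[yD yE] /andP[zD zE] xyz.
by rewrite !permM; apply: cyct => //; apply: cycs.
Qed.

(** * Rotations and their sign *)

Definition rotation n : 'S_n := perm (@ordS_inj n).

Lemma rotationE n (x : 'I_n) :
  rotation n x = (if x.+1 == n then 0 else x.+1) :> nat.
Proof.
rewrite permE /=; case: eqP => [->|]; first exact: modnn.
by move=> ne; rewrite modn_small // ltn_neqAle ltn_ord andbT; apply/eqP.
Qed.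

Lemma rotationX n k (x : 'I_n) : (rotation n ^+ k) x = (x + k) %% n :> nat.
Proof.
elim: k => [|k IH]; first by rewrite expg0 perm1 addn0 modn_small.
by rewrite expgSr permM permE /= IH -addn1 modnDml -addnA addn1.
Qed.

Lemma cyc_rotation n k : cyc_on setT (rotation n ^+ k).
Proof.
elim: k => [|k IH] x y z _ _ _ h; first by rewrite expg0 !perm1.
rewrite expgSr !permM.
have {h} := IH x y z (in_setT _) (in_setT _) (in_setT _) h.
move: (_ x) (_ y) (_ z) => {IH}x {}y {}z.
rewrite /cyc !rotationE.
have := ltn_ord x; have := ltn_ord y; have := ltn_ord z.
by case: eqP => ?; case: eqP => ?; case: eqP => ?; lia.
Qed.

Lemma even_rotationX n k : odd n || ~~ odd k -> ~~ odd_perm (rotation n ^+ k).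
Proof.
have even2 j : ~~ odd_perm (rotation n ^+ (j + j)).
  by rewrite expgD odd_permM addbb.
case: (boolP (odd k)) => [ok|ek _]; last first.
  by have -> : k = k./2 + k./2 by lia.
(* For [k] and [n] odd, adding a full turn makes the exponent even, hence the power a square. *)
rewrite orbF => on; have -> : rotation n ^+ k = rotation n ^+ (k + n).
  by apply/permP=> x; apply/val_inj; rewrite /= !rotationX addnA modnDr.
by have -> : k + n = (k + n)./2 + (k + n)./2 by lia.
Qed.

(** No point lies strictly between a point and its successor, so [t] commutes with the one-step
    rotation and is determined by its value at [0]. *)
Lemma cyc_on_rotation n (t : 'S_n) :
  cyc_on setT t -> exists k, t = rotation n ^+ k.
Proof.
case: n t => [|n] t cyct.
  by exists 0; apply/permP=> -[].
have tr x : t (rotation _ x) = rotation _ (t x).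
  have [|ne] := eqVneq (t (rotation _ x)) (rotation _ (t x)) => //.
  have [w tw] : exists w, t w = rotation _ (t x).
    by exists (t^-1 (rotation _ (t x))); rewrite permKV.
  have nwr : w != rotation _ x by apply: contra_neq ne => <-.
  have [wx|nwx] := eqVneq w x.
    move/(congr1 val): tw; rewrite wx /= rotationE => tx.
    have n0 : n = 0 by case: eqP tx; lia.
    by subst n; rewrite (ord1 (t _)) (ord1 (rotation _ (t x))).
  (* If [w] is neither [x] nor its successor, the image of that successor would fall strictly
     between [t x] and the successor of [t x]. *)
  have : cyc (t x) (t (rotation _ x)) (t w).
    apply: cyct; rewrite ?inE //.
    move: nwr nwx; rewrite -!val_eqE /= rotationE /cyc.
    by have := ltn_ord x; have := ltn_ord w; case: (x.+1 =P n.+1) => ?; lia.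
  rewrite tw /cyc rotationE.
  have := ltn_ord (t x); have := ltn_ord (t (rotation n.+1 x)).
  by case: eqP => ?; lia.
exists (t ord0); apply/permP=> x.
have xE : x = (rotation _ ^+ x) ord0.
  by apply/val_inj; rewrite /= rotationX add0n modn_small.
rewrite {1}xE.
have -> k y : t ((rotation _ ^+ k) y) = (rotation _ ^+ k) (t y).
  by elim: k => [|k IH]; rewrite ?expg0 ?perm1 // expgSr !permM tr IH.
by apply/val_inj; rewrite /= !rotationX addnC.
Qed.

Lemma cyc_on_even n (t : 'S_n) : odd n -> cyc_on setT t -> ~~ odd_perm t.
Proof. by move=> on /cyc_on_rotation[k ->]; rewrite even_rotationX ?on. Qed.

(** * Deleting one point from a permutation *)

Lemma perm_lift n (s : 'S_n.+1) i : exists t, s = lift_perm i (s i) t.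
Proof.
(* The default [k] is never reached: [s (lift i k)] differs from [s i]. *)
pose f k := odflt k (unlift (s i) (s (lift i k))).
have fE k : s (lift i k) = lift (s i) (f k).
  have : s i != s (lift i k) by rewrite inj_eq ?neq_lift //; apply: perm_inj.
  by rewrite /f => /unlift_some[l -> ->].
have injf : injective f.
  by move=> k l fkl; apply/(@lift_inj _ i)/(@perm_inj _ s); rewrite !fE fkl.
exists (perm injf); apply/permP=> x; case: (unliftP i x) => [k ->|->].
  by rewrite lift_perm_lift permE fE.
by rewrite lift_perm_id.
Qed.

Lemma cyc_lift n (i : 'I_n.+1) (x y z : 'I_n) :
  cyc (lift i x) (lift i y) (lift i z) = cyc x y z.
Proof. by rewrite /cyc /= !ltnNge !leq_bump2. Qed.

(** Here [n] counts the points other than [i]. Relabelled, [s] becomes a rotation of these, which is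
    even, so only the moves of [i] and [s i] to a common place contribute to the sign. *)
Lemma odd_defect n (s : 'S_n.+1) i :
  odd n -> cyc_on [set~ i] s -> odd_perm s = odd i (+) odd (s i).
Proof.
move=> on cycs; have [t st] := perm_lift s i.
rewrite [in LHS]st odd_lift_perm (negPf (cyc_on_even on _)) ?addbF //.
move=> x y z _ _ _; rewrite -(cyc_lift i).
move/cycs; rewrite !inE ![_ == i]eq_sym !neq_lift => /(_ isT isT isT).
by rewrite st !lift_perm_lift cyc_lift.
Qed.

(** * Ideals of [AOP n] and the relation J *)

Lemma is_dP n (a : pperm n) i : is_d a i -> Defs.dom a = [set~ i].
Proof. by move=> <-; rewrite setCK. Qed.

Lemma in_ideal_trans (G : monoidType) (M : {pred G}) (a b x : G) :
  {in M &, forall u v, u * v \in M} ->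
  in_ideal M a b -> in_ideal M b x -> in_ideal M a x.
Proof.
move=> mulM [u [v [uM vM ->]]] [u' [v' [uM' vM' ->]]].
by exists (u' * u), (v * v'); rewrite !mulM // !mulgA.
Qed.

Lemma in_ideal_AOP n (a b : pperm n) (i j : 'I_n) : a \in AOP n -> b \in AOP n ->
  is_d a i -> is_d b j -> odd n || (odd i == odd j) -> in_ideal (AOP n) a b.
Proof.
move=> /AOPP[s [D [-> evens cycs]]] bA /is_dP; rewrite dom_pres => Di.
have /AOPP[t [E [bE event cyct]]] := bA; subst b; move=> /is_dP; rewrite dom_pres => Ej.
subst D E; move=> par; pose r := rotation n ^+ (i + n - j).
(* The summand [n] in the exponent keeps the subtraction of [j] from truncating, and adds only a
   full turn. *)
have rj : r j = i.
  apply/val_inj; rewrite /= rotationX subnKC; last by rewrite ltnW ?ltn_addl.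
  by rewrite modnDr modn_small.
have evenr : ~~ odd_perm r.
  apply: even_rotationX; rewrite oddB ?oddD; last by rewrite ltnW ?ltn_addl.
  by case/orP: par => [->//|/eqP->]; case: (odd n); rewrite ?addbF ?addbb.
have rA : pres r setT \in AOP n.
  by apply/AOPP; exists r, setT; split=> //; apply: cyc_rotation.
have rVA : pres r^-1 setT \in AOP n.
  apply/AOPP; exists r^-1, setT; split; rewrite ?odd_permV //.
  rewrite -[setT](_ : r @: setT = _); first exact/cyc_on_inv/cyc_rotation.
  apply/setP=> x; rewrite inE; apply/imsetP.
  by exists (r^-1 x); rewrite ?permKV.
have sVA : pres s^-1 (s @: [set~ i]) \in AOP n.
  apply/AOPP; exists s^-1, (s @: [set~ i]).
  by split; rewrite ?odd_permV //; apply: cyc_on_inv.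
exists (pres r setT).
exists (pres s^-1 (s @: [set~ i]) * pres r^-1 setT * pres t [set~ j]).
split=> //; first by do 2?apply: AOPM.
rewrite !presM !mulgA mulgK mulgV mul1g; congr pres.
(* The permutations cancel to [t]; the domains agree because [r x] avoids [i] exactly when [x]
   avoids [j]. *)
apply/setP=> x; rewrite !inE.
rewrite !permM !permK (mem_imset _ _ perm_inj) !inE -rj (inj_eq perm_inj).
by case: (x != j).
Qed.

Lemma green_J_AOP n (a b : pperm n) (i j : 'I_n) : a \in AOP n -> b \in AOP n ->
  is_d a i -> is_d b j -> odd n || (odd i == odd j) -> green_J (AOP n) a b.
Proof.
move=> aA bA ai bj par x; split; apply: in_ideal_trans (@AOPM n) _.
  by apply: in_ideal_AOP bA aA bj ai _; rewrite eq_sym.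
exact: in_ideal_AOP aA bA ai bj par.
Qed.

Lemma green_J_odd n (a b : pperm n) (i j : 'I_n) : ~~ odd n ->
  is_d a i -> is_d b j -> green_J (AOP n) a b -> odd i = odd j.
Proof.
case: n a b i j => [|n] a b i j; first by case: i.
rewrite /= negbK => on /is_dP ai /is_dP bj /(_ b)[_ ideal].
have [|u [v [/AOPP[s [D [-> evens cycs]]] _ bE]]] := ideal.
  by exists 1, 1; rewrite !AOP1 mul1g mulg1.
have dombP x : x \in Defs.dom b -> x \in D /\ s x \in Defs.dom a.
  rewrite !inE bE pcompE [X in obind _ X]pcompE presE.
  by case: (x \in D) => //=; case: (pperm_fun a (s x)).
(* Otherwise [s^-1 i] would lie in the domain of [b], although [s] sends it to [i], where [a] is
   undefined. *)
have sj : s j = i.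
  apply: contraTeq isT => ne.
  have : s^-1 i \in Defs.dom b.
    by rewrite bj !inE -(inj_eq (@perm_inj _ s)) permKV eq_sym.
  by case/dombP=> _; rewrite permKV ai !inE eqxx.
have := odd_defect on (s := s) (i := j).
rewrite sj (negPf evens) => h; apply/eqP; rewrite eq_sym -negb_add -h //.
move=> x y z; rewrite -bj => /dombP[xD _] /dombP[yD _] /dombP[zD _].
exact: cycs.
Qed.

Theorem proposition1p7 (n : nat) (a b : pperm n) :
  3 <= n -> a \in AOP n -> b \in AOP n -> rank a = n.-1 -> rank b = n.-1 ->
  (odd n -> green_J (AOP n) a b) /\
  (~~ odd n -> forall i j : 'I_n, is_d a i -> is_d b j ->
     (green_J (AOP n) a b <-> odd (label i) = odd (label j))).
Proof.
move=> n_ge3 aA bA ra rb; split=> [on | en i j ai bj].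
  have n_gt0 : 0 < n by apply: leq_trans n_ge3.
  have [i ai] := d_exists n_gt0 ra; have [j bj] := d_exists n_gt0 rb.
  by apply: green_J_AOP aA bA ai bj _; rewrite on.
(* Labels exceed ordinals by one, which flips both parities and keeps their equality. *)
rewrite /label /=; split=> [/(green_J_odd en ai bj)->//|/negb_inj ij].
by apply: green_J_AOP aA bA ai bj _; rewrite ij eqxx orbT.
Qed.
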